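(* Let $\alpha:I\to\mathbb{I}_{\mathrm p}^3$ be an admissible $C^4$ regular unit speed curve in pseudo-isotropic space, with an RM frame $\{\mathbf t,\mathbf n_1,\mathbf n_2=\mathbf b\}$ and natural curvatures $\kappa_1,\kappa_2$. Then $\alpha$ lies on the surface of a pseudo-isotropic sphere if and only if its normal development $s\mapsto(\kappa_1(s),\kappa_2(s))$ lies on a line of $\mathbb{R}^2$ not passing through the origin. In addition, $\alpha$ is a plane curve (its image lies in a plane) if and only if the normal development lies on a line passing through the origin.
   Context: Pseudo-isotropic space $\mathbb{I}_{\mathrm p}^3$ is $\mathbb{R}^3$ with the degenerate metric $\langle\mathbf u,\mathbf v\rangle_{z,\mathrm p}=u_1v_1-u_2v_2$ and $\Vert\mathbf v\Vert_{z,\mathrm p}=\sqrt{|\langle\mathbf v,\mathbf v\rangle_{z,\mathrm p}|}$. Its rigid motions are the maps $\bar x=a+x\cosh\phi+y\sinh\phi$, $\bar y=b+x\sinh\phi+y\cosh\phi$, $\bar z=c+c_1x+c_2y+z$, with $a,b,c,c_1,c_2,\phi\in\mathbb{R}$. A regular curve $\alpha=(x,y,z):I\to\mathbb{I}_{\mathrm p}^3$ on an interval $I$ is admissible if it has no inflection point ($\alpha',\alpha''$ are linearly independent everywhere) and $x'y''-x''y'\neq0$ everywhere. Only spacelike curves ($\langle\alpha',\alpha'\rangle_{z,\mathrm p}>0$ everywhere) or timelike curves ($\langle\alpha',\alpha'\rangle_{z,\mathrm p}<0$ everywhere) are considered. Unit speed means $\langle\alpha',\alpha'\rangle_{z,\mathrm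 p}=\epsilon$ with $\epsilon\in\{-1,+1\}$ constant. Frenet frame: $\mathbf t=\alpha'$, $\eta=-\epsilon$, $\kappa=\eta\Vert\alpha''\Vert_{z,\mathrm p}$ (nonzero), $\mathbf n=\mathbf t'/(\eta\kappa)$, $\mathbf b=(0,0,1)$. It satisfies $\mathbf t'=-\epsilon\kappa\mathbf n$, $\mathbf n'=-\epsilon\kappa\mathbf t+\tau\mathbf b$, $\mathbf b'=0$, which defines the torsion $\tau$. An RM frame is $\{\mathbf t,\mathbf n_1,\mathbf n_2=\mathbf b\}$ with $\mathbf n_1=\mathbf n-\theta\,\mathbf b$, $\theta(s)=\int_{s_0}^s\tau(x)\,\mathrm dx+\tau_0$ for some constant $\tau_0$. It satisfies $\mathbf t'=\eta\kappa_1\mathbf n_1+\kappa_2\mathbf n_2$, $\mathbf n_1'=-\epsilon\kappa_1\mathbf t$, $\mathbf n_2'=0$ with natural curvatures $\kappa_1=\kappa$, $\kappa_2=\eta\kappa\theta$. A pseudo-isotropic sphere is an irreducible surface of degree 2 of the form $(x^2-y^2)+2c_1x+2c_2y+2c_3z+c_4=0$ with $c_i\in\mathbb{R}$. Equivalently, it is, up to a rigid motion of $\mathbb{I}_{\mathrm p}^3$, one of the surfaces $z=\frac{1}{2p}(x^2-y^2)$ with $p\neq0$ (parabolic type) or $x^2-y^2=\pm r^2$ with $r>0$ (cylindrical type; both branches of the hyperbolic cylinder are included). *)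

(* Defs.v *)
From mathcomp Require Import all_boot all_algebra.
From mathcomp Require Import mpoly.
From mathcomp Require Import Rstruct.
From Stdlib Require Import Reals.
From Coquelicot Require Import Coquelicot.

(* The curve is handled with Coquelicot over the concrete reals [R]; the
   quadric is a Multinomials polynomial over the same [R], which is a field
   in the MathComp sense through [Rstruct]. *)

Open Scope R_scope.

(* Points and vectors, with Coquelicot's product normed module structure. *)
Definition vec3 : Type := (R * R * R)%type.
Definition cx (v : vec3) : R := v.1.1.
Definition cy (v : vec3) : R := v.1.2.
Definition cz (v : vec3) : R := v.2.

(* The degenerate metric of pseudo-isotropic space. *)
Definition ip (u v : vec3) : R := cx u * cx v - cy u * cy v.
Definition pnorm (v : vec3) : R := sqrt (Rabs (ip v v)).

(* Open, half-open, closed, bounded or unbounded; not reduced to a point. *)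
Definition is_interval (I : R -> Prop) : Prop :=
  (forall a b x, I a -> I b -> a <= x <= b -> I x) /\
  (exists a b, I a /\ I b /\ a < b).

(* Derivative on an interval, one-sided at an endpoint belonging to [I].
   Only the values of [f] and [df] on [I] matter. *)
Definition derivative_on (I : R -> Prop) (f df : R -> vec3) : Prop :=
  forall s, I s ->
    filterdiff f (within I (locally s)) (fun h : R => scal h (df s)).

Fixpoint class_C (k : nat) (I : R -> Prop) (f : R -> vec3) : Prop :=
  match k with
  | O => continuous_on I f
  | S k' => exists df, derivative_on I f df /\ class_C k' I df
  end.

Definition lin_indep (u v : vec3) : Prop :=
  forall a b : R, plus (scal a u) (scal b v) = zero -> a = 0 /\ b = 0.

(* [d1] and [d2] are the first and second derivatives of the curve. *)
Definition regular (I : R -> Prop) (d1 : R -> vec3) : Prop :=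
  forall s, I s -> d1 s <> zero.

Definition admissible (I : R -> Prop) (d1 d2 : R -> vec3) : Prop :=
  forall s, I s ->
    lin_indep (d1 s) (d2 s) /\ cx (d1 s) * cy (d2 s) - cx (d2 s) * cy (d1 s) <> 0.

Definition unit_speed (I : R -> Prop) (eps : R) (d1 : R -> vec3) : Prop :=
  (eps = 1 \/ eps = -1) /\ forall s, I s -> ip (d1 s) (d1 s) = eps.

Definition eta (eps : R) : R := - eps.
Definition bvec : vec3 := (0, 0, 1).

(* [t'] is the derivative of the unit tangent [t]. The last field is the
   Frenet equation for [n], which determines the torsion on [I]. *)
Record frenet_frame (I : R -> Prop) (eps : R) (t t' n : R -> vec3)
    (kappa tau : R -> R) : Prop := {
  frenet_kappa : forall s, I s -> kappa s = eta eps * pnorm (t' s);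
  frenet_n : forall s, I s -> n s = scal (/ (eta eps * kappa s)) (t' s);
  frenet_tau : derivative_on I n
    (fun s => plus (scal (- eps * kappa s) (t s)) (scal (tau s) bvec))
}.

(* [{t, n1, bvec}] is an RM frame, with angle [theta], of the curve with
   Frenet normal [n] and torsion [tau]. *)
Record RM_frame (I : R -> Prop) (n : R -> vec3) (tau theta : R -> R)
    (n1 : R -> vec3) : Prop := {
  RM_theta : exists s0 theta0, I s0 /\
    forall s, I s -> theta s = RInt tau s0 s + theta0;
  RM_n1 : forall s, I s -> n1 s = minus (n s) (scal (theta s) bvec)
}.

Record natural_curvatures (I : R -> Prop) (eps : R) (kappa theta : R -> R)
    (kappa1 kappa2 : R -> R) : Prop := {
  natural_kappa1 : forall s, I s -> kappa1 s = kappa s;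
  natural_kappa2 : forall s, I s -> kappa2 s = eta eps * kappa s * theta s
}.

Definition is_line (L : R * R -> Prop) : Prop :=
  exists a b c : R, (a <> 0 \/ b <> 0) /\
    forall p, L p <-> a * p.1 + b * p.2 = c.

Definition is_plane (P : vec3 -> Prop) : Prop :=
  exists a b c d : R, (a <> 0 \/ b <> 0 \/ c <> 0) /\
    forall p, P p <-> a * cx p + b * cy p + c * cz p = d.

Section Spheres.
Local Open Scope ring_scope.

Definition irreducible_mpoly {n : nat} (p : {mpoly R[n]}) : Prop :=
  [/\ p != 0, p \isn't a GRing.unit &
      forall q r : {mpoly R[n]}, p = q * r ->
        q \is a GRing.unit \/ r \is a GRing.unit].

Definition coords (v : vec3) : 'I_3 -> R :=
  fun i => nth 0 [:: cx v; cy v; cz v] i.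

Definition sphere_poly (c1 c2 c3 c4 : R) : {mpoly R[3]} :=
  let x := 'X_(inord 0) in let y := 'X_(inord 1) in let z := 'X_(inord 2) in
  (x ^+ 2 - y ^+ 2) + (2 * c1) *: x + (2 * c2) *: y + (2 * c3) *: z + c4%:MP.

Definition is_pseudo_isotropic_sphere (S : vec3 -> Prop) : Prop :=
  exists c1 c2 c3 c4 : R,
    irreducible_mpoly (sphere_poly c1 c2 c3 c4) /\
    forall p, S p <-> (sphere_poly c1 c2 c3 c4).@[coords p] = 0.

End Spheres.

Definition lies_on {T : Type} (I : R -> Prop) (f : R -> T) (S : T -> Prop) : Prop :=
  forall s, I s -> S (f s).

(* Main.v *)
Require Import Defs.
From Stdlib Require Import Reals Psatz.
From Coquelicot Require Import Coquelicot.
From mathcomp Require Import all_boot all_algebra.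
From mathcomp Require Import mpoly.
From mathcomp Require Import Rstruct.

Open Scope R_scope.

(** The curve obeys a linear moving-frame system. Put mu = -eps kappa, which is
positive, and w = n_z - theta, the height of the RM normal; then

  t' = mu n,   (n_x, n_y)' = mu (t_x, t_y),   w' = mu t_z,   n_z = w + theta,

while kappa1 = -eps mu and kappa2 = mu theta. The plane vectors (t_x, t_y) and
(n_x, n_y) are orthogonal for u1 v1 - u2 v2, with squares eps and -eps.

A sphere x^2 - y^2 + 2 c1 x + 2 c2 y + 2 c3 z + c4 = 0 contains the curve only
if the derivative of its equation vanishes: with X = x + c1 and Y = y - c2,

  A = X t_x - Y t_y + c3 t_z = 0.

The companion G = X n_x - Y n_y + c3 w has derivative mu A = 0, so it is a
constant g, and A' = 0 reads eps + mu (g + c3 theta) = 0. In terms of the natural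
curvatures this is the line -eps g kappa1 + c3 kappa2 = -eps, which misses the
origin because eps <> 0. Conversely a line gives g and c3; at each parameter the
equations A = 0 and G = g determine (X, Y), and the relation
eps + mu (g + c3 theta) = 0 says exactly that (X, Y)' = (x, y)', so that the
centre of the sphere does not move. A plane a x + b y + c z = d is
the same computation with (X, Y) = (a, -b) constant: the term eps, which comes
from (X, Y)' = (t_x, t_y), disappears, and the line passes through the origin.
Both cases are treated together by requiring (X, Y)' = sigma (t_x, t_y), with
sigma = 1 for spheres and sigma = 0 for planes ([relation_of_support],
[support_of_relation]).

Two points need separate care. The identity theta' = tau requires tau to be
continuous, which is where the smoothness of the curve enters
([frenet_RM_equations]). And the quadric that is found must be irreducible: the
polynomial factors only if c3 = 0 and c4 = c1^2 - c2^2
([irreducible_sphere_poly]), and in the case c3 = 0 one has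
c4 - (c1^2 - c2^2) = eps g^2 with g <> 0. *)

(** * Calculus relative to an interval *)

Definition diff_on (I : R -> Prop) (f df : R -> R) : Prop :=
  forall s, I s -> D_in f df I s.

Definition cont_on (I : R -> Prop) (f : R -> R) : Prop :=
  forall s, I s -> continue_in f I s.

(** [continue_in] is a punctured limit; including the centre itself avoids a case
distinction at each use. *)
Lemma cont_onP (I : R -> Prop) (f : R -> R) :
  cont_on I f <->
  forall s, I s -> forall e, 0 < e -> exists d, 0 < d /\
    forall y, I y -> Rabs (y - s) < d -> Rabs (f y - f s) < e.
Proof.
split; intros H s Is.
- intros e He. destruct (H s Is e He) as [d [Hd Hy]]. exists d; split; [exact Hd|].
  intros y Iy Hys. destruct (Req_dec s y) as [<-|sy].
  + rewrite Rminus_diag Rabs_R0. exact He.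
  + apply (Hy y). repeat split; assumption.
- intros e He. destruct (H s Is e He) as [d [Hd Hy]]. exists d; split; [exact Hd|].
  intros y [[Iy _] Hys]. apply Hy; assumption.
Qed.

Lemma diff_onP (I : R -> Prop) (f df : R -> R) :
  diff_on I f df <->
  forall s, I s -> forall e, 0 < e -> exists d, 0 < d /\
    forall y, I y -> y <> s -> Rabs (y - s) < d ->
      Rabs ((f y - f s) / (y - s) - df s) < e.
Proof.
split; intros H s Is e He; destruct (H s Is e He) as [d [Hd Hy]];
  exists d; split; try exact Hd.
- intros y Iy ys Hys. apply (Hy y). repeat split; try assumption. congruence.
- intros y [[Iy sy] Hys]. apply Hy; try assumption. congruence.
Qed.

Lemma diff_on_ext (I : R -> Prop) (f g df dg : R -> R) :
  (forall s, I s -> f s = g s) -> (forall s, I s -> df s = dg s) ->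
  diff_on I f df -> diff_on I g dg.
Proof.
rewrite !diff_onP. intros fg dfg Hf s Is e He.
destruct (Hf s Is e He) as [d [Hd Hy]]. exists d; split; [exact Hd|].
intros y Iy. rewrite <- !fg, <- dfg by assumption. exact (Hy y Iy).
Qed.

Lemma diff_on_eq_derivative {I : R -> Prop} {f df : R -> R} (dg : R -> R) :
  (forall s, I s -> df s = dg s) -> diff_on I f df -> diff_on I f dg.
Proof. exact (diff_on_ext I f f df dg (fun _ _ => erefl)). Qed.

Lemma diff_on_eq_function {I : R -> Prop} {f df : R -> R} (g : R -> R) :
  (forall s, I s -> f s = g s) -> diff_on I f df -> diff_on I g df.
Proof. intros fg. exact (diff_on_ext I f g df df fg (fun _ _ => erefl)). Qed.

Lemma cont_on_ext {I : R -> Prop} {f g : R -> R} :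
  (forall s, I s -> f s = g s) -> cont_on I f -> cont_on I g.
Proof.
rewrite !cont_onP. intros fg Hf s Is e He.
destruct (Hf s Is e He) as [d [Hd Hy]]. exists d; split; [exact Hd|].
intros y Iy. rewrite <- !fg by assumption. exact (Hy y Iy).
Qed.

Lemma diff_on_cont {I : R -> Prop} {f df : R -> R} :
  diff_on I f df -> cont_on I f.
Proof. intros H s Is. exact (cont_deriv _ _ _ _ (H s Is)). Qed.

Lemma diff_on_const (I : R -> Prop) (c : R) :
  diff_on I (fun _ => c) (fun _ => 0).
Proof. intros s _. apply Dconst. Qed.

Lemma diff_on_plus {I : R -> Prop} {f g df dg : R -> R} :
  diff_on I f df -> diff_on I g dg ->
  diff_on I (fun s => f s + g s) (fun s => df s + dg s).
Proof. intros Hf Hg s Is. apply Dadd; auto. Qed.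

Lemma diff_on_minus {I : R -> Prop} {f g df dg : R -> R} :
  diff_on I f df -> diff_on I g dg ->
  diff_on I (fun s => f s - g s) (fun s => df s - dg s).
Proof. intros Hf Hg s Is. apply Dminus; auto. Qed.

Lemma diff_on_mult {I : R -> Prop} {f g df dg : R -> R} :
  diff_on I f df -> diff_on I g dg ->
  diff_on I (fun s => f s * g s) (fun s => df s * g s + f s * dg s).
Proof. intros Hf Hg s Is. apply Dmult; auto. Qed.

Lemma diff_on_scal {I : R -> Prop} (c : R) {f df : R -> R} :
  diff_on I f df -> diff_on I (fun s => c * f s) (fun s => c * df s).
Proof. intros Hf s Is. apply Dmult_const; auto. Qed.

Lemma cont_on_minus {I : R -> Prop} {f g : R -> R} :
  cont_on I f -> cont_on I g -> cont_on I (fun s => f s - g s).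
Proof. intros Hf Hg s Is. apply limit_minus; [apply Hf|apply Hg]; exact Is. Qed.

Lemma cont_on_plus {I : R -> Prop} {f g : R -> R} :
  cont_on I f -> cont_on I g -> cont_on I (fun s => f s + g s).
Proof. intros Hf Hg s Is. apply limit_plus; [apply Hf|apply Hg]; exact Is. Qed.

Lemma cont_on_mult {I : R -> Prop} {f g : R -> R} :
  cont_on I f -> cont_on I g -> cont_on I (fun s => f s * g s).
Proof. intros Hf Hg s Is. apply limit_mul; [apply Hf|apply Hg]; exact Is. Qed.

Lemma cont_on_inv (I : R -> Prop) (f : R -> R) :
  (forall s, I s -> f s <> 0) -> cont_on I f -> cont_on I (fun s => / f s).
Proof. intros nz Hf s Is. apply limit_inv; [apply Hf|apply nz]; exact Is. Qed.

(** Every point of a nondegenerate interval is a limit of other points of it,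
which makes the relative limit of the difference quotients unique. *)
Lemma diff_on_unique {I : R -> Prop} {f d1 d2 : R -> R} :
  is_interval I -> diff_on I f d1 -> diff_on I f d2 ->
  forall s, I s -> d1 s = d2 s.
Proof.
intros [conv [a [b [Ia [Ib ab]]]]] H1 H2 s Is.
refine (single_limit _ _ _ _ _ _ (H1 s Is) (H2 s Is)).
intros d Hd.
assert (exists y, I y /\ y <> s /\ Rabs (y - s) < d) as [y [Iy [ys Hy]]].
{ destruct (Rlt_le_dec s b) as [sb|bs].
  - exists (Rmin b (s + d / 2)). unfold Rmin, Rabs.
    destruct (Rle_dec b (s + d / 2)); destruct (Rcase_abs _);
      (split; [apply (conv s b); [..|split]|split]); auto; lra.
  - exists (Rmax a (s - d / 2)). unfold Rmax, Rabs.
    destruct (Rle_dec a (s - d / 2)); destruct (Rcase_abs _);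
      (split; [apply (conv a s); [..|split]|split]); auto; lra. }
exists y. repeat split; auto.
Qed.

(** Composing with this retraction onto [[a, b]] extends a function on an interval
to the whole line, where the mean value theorem and the theory of the
Riemann integral apply with two-sided limits. *)
Definition clamp (a b r : R) : R := Rmax a (Rmin b r).

Lemma clamp_id (a b r : R) : a <= r <= b -> clamp a b r = r.
Proof.
intros H. unfold clamp. rewrite Rmin_right; [|lra]. apply Rmax_right; lra.
Qed.

Lemma clamp_between (a b r : R) : a <= b -> a <= clamp a b r <= b.
Proof.
intros H. unfold clamp, Rmax, Rmin.
destruct (Rle_dec b r); destruct (Rle_dec a _); lra.
Qed.

Lemma clamp_lipschitz (a b r q : R) :
  Rabs (clamp a b r - clamp a b q) <= Rabs (r - q).
Proof.
unfold clamp, Rmax, Rmin, Rabs.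
destruct (Rle_dec b r); destruct (Rle_dec b q);
  repeat (destruct (Rle_dec a _)); repeat (destruct (Rcase_abs _)); lra.
Qed.

Lemma cont_on_clamp (I : R -> Prop) (f : R -> R) (a b r : R) :
  is_interval I -> I a -> I b -> a <= b -> cont_on I f ->
  continuity_pt (fun r => f (clamp a b r)) r.
Proof.
intros [conv _] Ia Ib ab Hf e He.
assert (Ic : forall r, I (clamp a b r))
  by (intros q; exact (conv a b _ Ia Ib (clamp_between a b q ab))).
destruct (proj1 (cont_onP I f) Hf _ (Ic r) e He) as [d [Hd Hy]].
exists d; split; [exact Hd|].
intros y [_ Hyr]. apply Hy; [apply Ic|].
apply (Rle_lt_trans _ _ _ (clamp_lipschitz a b y r) Hyr).
Qed.

Lemma diff_on_clamp (I : R -> Prop) (f df : R -> R) (a b r : R) :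
  is_interval I -> I a -> I b -> diff_on I f df -> a < r < b ->
  is_derive (fun r => f (clamp a b r)) r (df r).
Proof.
intros [conv _] Ia Ib Hf arb. apply is_derive_Reals. intros e He.
assert (Ir : I r) by (apply (conv a b); auto; lra).
destruct (proj1 (diff_onP I f df) Hf r Ir e He) as [d [Hd Hy]].
assert (Hm : 0 < Rmin d (Rmin (r - a) (b - r)))
  by (repeat apply Rmin_glb_lt; lra).
exists (mkposreal _ Hm). intros h h0 Hh. simpl in Hh.
pose proof (Rmin_l d (Rmin (r - a) (b - r))).
pose proof (Rmin_r d (Rmin (r - a) (b - r))).
pose proof (Rmin_l (r - a) (b - r)). pose proof (Rmin_r (r - a) (b - r)).
pose proof (Rle_abs h). pose proof (Rle_abs (- h)) as Hmh.
rewrite Rabs_Ropp in Hmh.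
rewrite !clamp_id; [|lra..].
assert (Irh : I (r + h)) by (apply (conv a b); auto; lra).
specialize (Hy (r + h) Irh). replace (r + h - r) with h in Hy by ring.
apply Hy; lra.
Qed.

Lemma constant_of_zero_derivative {I : R -> Prop} {f df : R -> R} :
  is_interval I -> diff_on I f df -> (forall s, I s -> df s = 0) ->
  forall s s', I s -> I s' -> f s = f s'.
Proof.
intros HI Hf df0.
assert (W : forall a b, I a -> I b -> a < b -> f a = f b).
{ intros a b Ia Ib ab.
  destruct (MVT_gen (fun r => f (clamp a b r)) a b df) as [c [Hc E]].
  - rewrite Rmin_left ?Rmax_right; [|lra..]. intros r Hr.
    exact (diff_on_clamp I f df a b r HI Ia Ib Hf Hr).
  - intros r _. apply (cont_on_clamp I); auto; [lra|].
    exact (diff_on_cont Hf).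
  - rewrite Rmin_left ?Rmax_right in Hc; [|lra..].
    rewrite !clamp_id in E; [|lra..].
    rewrite df0 in E; [lra|]. exact (proj1 HI a b c Ia Ib Hc). }
intros s s' Is Is'.
destruct (Rtotal_order s s') as [lt|[->|gt]]; auto.
symmetry; apply W; auto.
Qed.

(** Used to differentiate an identity that holds along the curve. *)
Lemma zero_derivative_of_constant {I : R -> Prop} {f df : R -> R} {k : R} :
  is_interval I -> diff_on I f df -> (forall s, I s -> f s = k) ->
  forall s, I s -> df s = 0.
Proof.
intros HI Hf fk. apply (diff_on_unique HI Hf).
refine (diff_on_eq_function _ _ (diff_on_const I k)).
intros s Is. symmetry. exact (fk s Is).
Qed.

(** The fundamental theorem of calculus for an integrand that is continuous only
relative to [I]. By the mean value theorem the difference quotient is a value of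
[f] between [s] and [y]. *)
Lemma diff_on_RInt (I : R -> Prop) (f : R -> R) (s0 : R) :
  is_interval I -> I s0 -> cont_on I f ->
  diff_on I (fun s => RInt f s0 s) f.
Proof.
intros HI Is0 Hf. apply diff_onP. intros s Is e He.
destruct (proj1 (cont_onP I f) Hf s Is e He) as [d [Hd Hy]].
exists d; split; [exact Hd|]. intros y Iy ys Hys.
(* [[a, b]] is the hull of [s0], [s] and [y], so all integrals below stay in it. *)
set (a := Rmin s0 (Rmin s y)). set (b := Rmax s0 (Rmax s y)).
assert (Ia : I a) by (unfold a, Rmin; repeat (destruct (Rle_dec _ _)); auto).
assert (Ib : I b) by (unfold b, Rmax; repeat (destruct (Rle_dec _ _)); auto).
assert (Ba : a <= s0 /\ a <= s /\ a <= y).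
{ unfold a, Rmin; repeat (destruct (Rle_dec _ _)); lra. }
assert (Bb : s0 <= b /\ s <= b /\ y <= b).
{ unfold b, Rmax; repeat (destruct (Rle_dec _ _)); lra. }
set (fc := fun r => f (clamp a b r)).
assert (Cfc : forall r, continuity_pt fc r)
  by (intros r; apply (cont_on_clamp I); auto; lra).
assert (Cfc' : forall r, continuous fc r)
  by (intros r; apply continuity_pt_filterlim, Cfc).
assert (Dfc : forall r, is_derive (fun r => RInt fc s0 r) r (fc r)).
{ intros r. apply (is_derive_RInt fc _ s0); [|apply Cfc'].
  apply filter_forall. intros q. apply (RInt_correct (V := R_CompleteNormedModule)).
  apply (ex_RInt_continuous (V := R_CompleteNormedModule)).
  intros z _. apply Cfc'. }
assert (E : forall r, a <= r <= b -> RInt f s0 r = RInt fc s0 r).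
{ intros r Hr. apply RInt_ext. intros q Hq. unfold fc. rewrite clamp_id; [reflexivity|].
  revert Hq; unfold Rmin, Rmax; destruct (Rle_dec s0 r); lra. }
rewrite !E; [|lra..].
destruct (MVT_gen (fun r => RInt fc s0 r) s y fc) as [c [Hc Ec]].
- intros r _. apply Dfc.
- intros r _. apply continuity_pt_filterlim.
  apply (ex_derive_continuous (V := R_NormedModule)). exists (fc r). apply Dfc.
- rewrite Ec.
  assert (Hc' : a <= c <= b /\ Rabs (c - s) <= Rabs (y - s)).
  { revert Hc; unfold Rmin, Rmax, Rabs;
    destruct (Rle_dec s y); repeat (destruct (Rcase_abs _)); lra. }
  unfold fc. rewrite clamp_id; [|lra].
  replace (f c * (y - s) / (y - s)) with (f c) by (field; lra).
  apply Hy; [|lra]. apply (proj1 HI a b); auto; lra.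
Qed.

(** A linear form of norm at most one maps the error term of the vector derivative
to an error term that is no larger. *)
Lemma derivative_on_component (I : R -> Prop) (f df : R -> vec3) (p : vec3 -> R) :
  (forall u v, p (minus u v) = p u - p v) ->
  (forall (k : R) u, p (scal k u) = k * p u) ->
  (forall v, Rabs (p v) <= norm v) ->
  derivative_on I f df ->
  diff_on I (fun s => p (f s)) (fun s => p (df s)).
Proof.
intros pB pZ pN Hf. apply diff_onP. intros s Is e He.
(* Half of [e], since the vector estimate is not strict. *)
assert (He2 : 0 < e / 2) by lra.
destruct (Hf s Is) as [_ Hlim].
assert (Hs : is_filter_lim (within I (locally s)) s)
  by (intros P HP; apply filter_le_within; exact HP).
destruct (Hlim s Hs (mkposreal _ He2)) as [d Hd]. simpl in Hd.
exists d; split; [apply cond_pos|]. intros y Iy ys Hys.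
specialize (Hd y Hys Iy).
pose proof (Rle_trans _ _ _ (pN _) Hd) as Hp.
rewrite !pB pZ in Hp.
change (norm (minus y s)) with (Rabs (y - s)) in Hp.
change (minus y s) with (y - s) in Hp.
assert (Hne : y - s <> 0) by lra.
assert (Hpos : 0 < Rabs (y - s)) by (apply Rabs_pos_lt; exact Hne).
replace ((p (f y) - p (f s)) / (y - s) - p (df s)) with
  ((p (f y) - p (f s) - (y - s) * p (df s)) / (y - s)) by (field; exact Hne).
unfold Rdiv. rewrite Rabs_mult Rabs_inv.
apply (Rmult_lt_reg_r (Rabs (y - s))); [exact Hpos|].
rewrite Rmult_assoc Rinv_l; [|lra]. nra.
Qed.

Lemma Rabs_components_le_norm (v : vec3) :
  Rabs (cx v) <= norm v /\ Rabs (cy v) <= norm v /\ Rabs (cz v) <= norm v.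
Proof.
destruct v as [[x y] z]; unfold cx, cy, cz; simpl.
pose proof (proj1 (norm_prod (K := R_AbsRing) (U := prod_NormedModule _ R_NormedModule R_NormedModule) (V := R_NormedModule) (x, y) z)) as H1.
pose proof (proj1 (norm_prod (K := R_AbsRing) (U := R_NormedModule) (V := R_NormedModule) x y)) as H2.
pose proof (Rmax_l (norm (V := prod_NormedModule _ R_NormedModule R_NormedModule) (x, y)) (norm z)).
pose proof (Rmax_r (norm (V := prod_NormedModule _ R_NormedModule R_NormedModule) (x, y)) (norm z)).
pose proof (Rmax_l (norm x) (norm y)).
pose proof (Rmax_r (norm x) (norm y)).
change (Rabs x) with (norm x). change (Rabs y) with (norm y). change (Rabs z) with (norm z).
split; [|split]; eapply Rle_trans; try exact H1; eauto using Rle_trans.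
Qed.

Lemma derivative_on_cx (I : R -> Prop) (f df : R -> vec3) :
  derivative_on I f df -> diff_on I (fun s => cx (f s)) (fun s => cx (df s)).
Proof.
apply derivative_on_component; try reflexivity.
intros v; apply (Rabs_components_le_norm v).
Qed.

Lemma derivative_on_cy (I : R -> Prop) (f df : R -> vec3) :
  derivative_on I f df -> diff_on I (fun s => cy (f s)) (fun s => cy (df s)).
Proof.
apply derivative_on_component; try reflexivity.
intros v; apply (Rabs_components_le_norm v).
Qed.

Lemma derivative_on_cz (I : R -> Prop) (f df : R -> vec3) :
  derivative_on I f df -> diff_on I (fun s => cz (f s)) (fun s => cz (df s)).
Proof.
apply derivative_on_component; try reflexivity.
intros v; apply (Rabs_components_le_norm v).
Qed.

(** * The moving frame equations and their first integrals *)

(** The system satisfied by the coordinates of the curve, of its tangent and of its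
RM normal. The height of the Frenet normal does not appear: it is [w + theta],
and using [w] eliminates the torsion from the system. *)
Record RM_equations (I : R -> Prop) (eps : R)
    (mu theta x y z tx ty tz nx ny w : R -> R) : Prop := {
  RM_x : diff_on I x tx;
  RM_y : diff_on I y ty;
  RM_z : diff_on I z tz;
  RM_tx : diff_on I tx (fun s => mu s * nx s);
  RM_ty : diff_on I ty (fun s => mu s * ny s);
  RM_tz : diff_on I tz (fun s => mu s * (w s + theta s));
  RM_nx : diff_on I nx (fun s => mu s * tx s);
  RM_ny : diff_on I ny (fun s => mu s * ty s);
  RM_w : diff_on I w (fun s => mu s * tz s);
  RM_eps : eps * eps = 1;
  RM_mu : forall s, I s -> 0 < mu s;
  RM_tt : forall s, I s -> tx s * tx s - ty s * ty s = eps;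
  RM_nn : forall s, I s -> nx s * nx s - ny s * ny s = - eps;
  RM_tn : forall s, I s -> tx s * nx s - ty s * ny s = 0
}.

Section RMEquations.
Context {I : R -> Prop} {eps : R}
  {mu theta x y z tx ty tz nx ny w : R -> R}
  (hI : is_interval I)
  (rm : RM_equations I eps mu theta x y z tx ty tz nx ny w).

(** The function [X n_x - Y n_y + c w] is a first integral because its derivative is
[sigma <t, n> + mu (X t_x - Y t_y + c t_z)]; differentiating the hypothesis
[X t_x - Y t_y + c t_z = 0] once then gives the relation between [mu] and
[theta]. *)
Lemma relation_of_support (sigma c : R) (X Y : R -> R) :
  diff_on I X (fun s => sigma * tx s) ->
  diff_on I Y (fun s => sigma * ty s) ->
  (forall s, I s -> X s * tx s - Y s * ty s + c * tz s = 0) ->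
  exists g, forall s, I s ->
    X s * nx s - Y s * ny s + c * w s = g /\
    sigma * eps + mu s * (g + c * theta s) = 0.
Proof.
destruct rm as [_ _ _ Dtx Dty Dtz Dnx Dny Dw _ _ Htt _ Htn].
intros DX DY HA.
pose proof (diff_on_plus (diff_on_minus
  (diff_on_mult DX Dtx) (diff_on_mult DY Dty))
  (diff_on_scal c Dtz)) as DA.
pose proof (diff_on_plus (diff_on_minus
  (diff_on_mult DX Dnx) (diff_on_mult DY Dny))
  (diff_on_scal c Dw)) as DG.
destruct (proj2 hI) as [s0 [_ [Is0 _]]].
exists (X s0 * nx s0 - Y s0 * ny s0 + c * w s0). intros s Is.
assert (G : X s * nx s - Y s * ny s + c * w s
  = X s0 * nx s0 - Y s0 * ny s0 + c * w s0).
{ refine (constant_of_zero_derivative hI DG _ s s0 Is Is0). intros r Ir.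
  transitivity (sigma * (tx r * nx r - ty r * ny r)
    + mu r * (X r * tx r - Y r * ty r + c * tz r)); [ring|].
  rewrite (Htn r Ir) (HA r Ir). ring. }
split; [exact G|].
pose proof (zero_derivative_of_constant hI DA HA s Is) as E.
simpl in E. rewrite <- G, <- E, <- (Htt s Is). ring.
Qed.

(** The converse: [(X, Y)] is defined by its products with [(t_x, t_y)] and
[(n_x, n_y)], that is by the conditions on [X t_x - Y t_y] and [X n_x - Y n_y].
The relation is then exactly what makes its derivative [sigma (t_x, t_y)]. The
square of [(X, Y)] determines the constant term of the sphere. *)
Lemma support_of_relation (sigma c g : R) :
  (forall s, I s -> sigma * eps + mu s * (g + c * theta s) = 0) ->
  exists X Y : R -> R,
    diff_on I X (fun s => sigma * tx s) /\
    diff_on I Y (fun s => sigma * ty s) /\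
    forall s, I s ->
      X s * tx s - Y s * ty s + c * tz s = 0 /\
      X s * nx s - Y s * ny s + c * w s = g /\
      X s * X s - Y s * Y s =
        eps * (c * tz s * (c * tz s) - (g - c * w s) * (g - c * w s)).
Proof.
destruct rm as [_ _ _ Dtx Dty Dtz Dnx Dny Dw ee _ Htt Hnn Htn].
intros H.
pose (A := fun s => - c * tz s). pose (G := fun s => g - c * w s).
pose proof (diff_on_scal (- c) Dtz) as DA.
pose proof (diff_on_minus (diff_on_const I g) (diff_on_scal c Dw)) as DG.
exists (fun s => eps * (A s * tx s - G s * nx s)),
  (fun s => eps * (A s * ty s - G s * ny s)).
split; [|split].
- refine (diff_on_eq_derivative _ _ (diff_on_scal eps (diff_on_minus
    (diff_on_mult DA Dtx) (diff_on_mult DG Dnx)))).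
  intros s Is. simpl.
  transitivity (sigma * (eps * eps) * tx s
    - eps * tx s * (sigma * eps + mu s * (g + c * theta s))).
  + ring.
  + rewrite (H s Is) ee. ring.
- refine (diff_on_eq_derivative _ _ (diff_on_scal eps (diff_on_minus
    (diff_on_mult DA Dty) (diff_on_mult DG Dny)))).
  intros s Is. simpl.
  transitivity (sigma * (eps * eps) * ty s
    - eps * ty s * (sigma * eps + mu s * (g + c * theta s))).
  + ring.
  + rewrite (H s Is) ee. ring.
- intros s Is. split; [|split].
  + transitivity (eps * A s * (tx s * tx s - ty s * ty s)
      - eps * G s * (tx s * nx s - ty s * ny s) + c * tz s); [ring|].
    rewrite (Htt s Is) (Htn s Is). unfold A.
    transitivity (c * tz s * (1 - eps * eps)); [ring|]. rewrite ee. ring.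
  + transitivity (eps * A s * (tx s * nx s - ty s * ny s)
      - eps * G s * (nx s * nx s - ny s * ny s) + c * w s); [ring|].
    rewrite (Hnn s Is) (Htn s Is). unfold G.
    transitivity (eps * eps * (g - c * w s) + c * w s); [ring|]. rewrite ee. ring.
  + transitivity (eps * eps * (A s * A s * (tx s * tx s - ty s * ty s)
      - 2 * A s * G s * (tx s * nx s - ty s * ny s)
      + G s * G s * (nx s * nx s - ny s * ny s))); [ring|].
    rewrite (Htt s Is) (Hnn s Is) (Htn s Is) ee. unfold A, G. ring.
Qed.

Definition quadric (c1 c2 c3 c4 : R) (s : R) : R :=
  x s * x s - y s * y s + 2 * c1 * x s + 2 * c2 * y s + 2 * c3 * z s + c4.

Lemma diff_on_quadric (c1 c2 c3 c4 : R) :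
  diff_on I (quadric c1 c2 c3 c4)
    (fun s => 2 * ((x s + c1) * tx s - (y s - c2) * ty s + c3 * tz s)).
Proof.
destruct rm as [Dx Dy Dz _ _ _ _ _ _ _ _ _ _ _].
refine (diff_on_eq_derivative _ _
  (diff_on_plus (diff_on_plus (diff_on_plus
  (diff_on_plus (diff_on_minus
  (diff_on_mult Dx Dx) (diff_on_mult Dy Dy))
  (diff_on_scal (2 * c1) Dx)) (diff_on_scal (2 * c2) Dy))
  (diff_on_scal (2 * c3) Dz)) (diff_on_const I c4))).
intros s _. simpl. ring.
Qed.

(** The derivative of the quadric along the curve is twice the pairing of
[relation_of_support] for the vector [(x + c1, y - c2)], whose derivative is
[(t_x, t_y)]. *)
Lemma relation_of_quadric (c1 c2 c3 c4 : R) :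
  (forall s, I s -> quadric c1 c2 c3 c4 s = 0) ->
  exists g, forall s, I s -> eps + mu s * (g + c3 * theta s) = 0.
Proof.
intros H.
pose proof rm as [Dx Dy _ _ _ _ _ _ _ _ _ _ _ _].
destruct (relation_of_support 1 c3 (fun s => x s + c1) (fun s => y s - c2))
  as [g Hg].
- refine (diff_on_eq_derivative _ _
    (diff_on_plus Dx (diff_on_const I c1))).
  intros s _. simpl. ring.
- refine (diff_on_eq_derivative _ _
    (diff_on_minus Dy (diff_on_const I c2))).
  intros s _. simpl. ring.
- intros s Is.
  pose proof (zero_derivative_of_constant hI (diff_on_quadric c1 c2 c3 c4)
    H s Is) as E.
  simpl in E. lra.
- exists g. intros s Is. rewrite -(proj2 (Hg s Is)). ring.
Qed.

(** The vector [(X, Y)] of [support_of_relation] differs from [(x, y)] by a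
constant, which gives the centre; [c4] is then fixed by one point of the curve.
The first conclusion is the irreducibility condition: for [c3 = 0] the square of
[(X, Y)] is [- eps g^2], and [g = 0] would contradict the relation. *)
Lemma quadric_of_relation (g c3 : R) :
  (forall s, I s -> eps + mu s * (g + c3 * theta s) = 0) ->
  exists c1 c2 c4,
    (c3 <> 0 \/ c4 <> c1 * c1 - c2 * c2) /\
    forall s, I s -> quadric c1 c2 c3 c4 s = 0.
Proof.
intros H.
destruct (support_of_relation 1 c3 g) as [X [Y [DX [DY HXY]]]].
{ intros s Is. rewrite -(H s Is). ring. }
destruct rm as [Dx Dy _ _ _ _ _ _ _ ee Hmu Htt Hnn Htn].
destruct (proj2 hI) as [s0 [_ [Is0 _]]].
set (c1 := X s0 - x s0). set (c2 := y s0 - Y s0).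
assert (EX : forall s, I s -> X s = x s + c1).
{ intros s Is.
  pose proof (constant_of_zero_derivative hI (diff_on_minus DX Dx)
    ltac:(intros r _; simpl; ring) s s0 Is Is0) as E.
  simpl in E. unfold c1. lra. }
assert (EY : forall s, I s -> Y s = y s - c2).
{ intros s Is.
  pose proof (constant_of_zero_derivative hI (diff_on_minus DY Dy)
    ltac:(intros r _; simpl; ring) s s0 Is Is0) as E.
  simpl in E. unfold c2. lra. }
exists c1, c2, (- quadric c1 c2 c3 0 s0). split.
- destruct (Req_dec c3 0) as [c3_0|]; [right|left; assumption].
  destruct (HXY s0 Is0) as [_ [_ N]]. specialize (H s0 Is0).
  assert (g_nz : g <> 0).
  { intros g0. rewrite g0 c3_0 in H. assert (eps0 : eps = 0) by lra.
    rewrite eps0 in ee. lra. }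
  rewrite (EX s0 Is0) (EY s0 Is0) c3_0 in N.
  unfold quadric. rewrite c3_0. intros E.
  assert (E' : eps * (g * g) = 0) by lra.
  apply g_nz. assert (g * g = 0); [|nra].
  transitivity (eps * (eps * (g * g))); [|rewrite E'; ring].
  rewrite -Rmult_assoc ee. ring.
- intros s Is.
  pose proof (constant_of_zero_derivative hI (diff_on_quadric c1 c2 c3 0)
    ltac:(intros r Ir; simpl; destruct (HXY r Ir) as [HA _];
      rewrite (EX r Ir) (EY r Ir) in HA; rewrite HA; ring) s s0 Is Is0) as E.
  rewrite -E. unfold quadric. ring.
Qed.

(** [g] and [c] cannot both vanish: [(a, -b)] would then be orthogonal to both
[(t_x, t_y)] and [(n_x, n_y)], hence zero. *)
Lemma relation_of_plane (a b c d : R) :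
  a <> 0 \/ b <> 0 \/ c <> 0 ->
  (forall s, I s -> a * x s + b * y s + c * z s = d) ->
  exists g, (g <> 0 \/ c <> 0) /\
    forall s, I s -> mu s * (g + c * theta s) = 0.
Proof.
intros abc H. destruct rm as [Dx Dy Dz _ _ _ _ _ _ ee _ Htt Hnn Htn].
pose proof (zero_derivative_of_constant hI (diff_on_plus (diff_on_plus
  (diff_on_scal a Dx) (diff_on_scal b Dy)) (diff_on_scal c Dz)) H) as HA.
simpl in HA.
destruct (relation_of_support 0 c (fun _ => a) (fun _ => - b)) as [g Hg].
- refine (diff_on_eq_derivative _ _ (diff_on_const I a)).
  intros s _. ring.
- refine (diff_on_eq_derivative _ _ (diff_on_const I (- b))).
  intros s _. ring.
- intros s Is. rewrite <- (HA s Is). ring.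
- exists g. split.
  + destruct (Req_dec c 0) as [c0|]; [left|right; assumption].
    intros g0. destruct (proj2 hI) as [s [_ [Is _]]].
    specialize (HA s Is). destruct (Hg s Is) as [HG _].
    specialize (Htt s Is). specialize (Hnn s Is). specialize (Htn s Is).
    rewrite c0 in HA HG. rewrite g0 in HG.
    (* The determinant of [(t_x, t_y)] and [(n_x, n_y)] squares to 1, by
       Lagrange's identity for the indefinite metric. *)
    assert (D : (tx s * ny s - ty s * nx s) * (tx s * ny s - ty s * nx s) = 1).
    { transitivity ((tx s * nx s - ty s * ny s) * (tx s * nx s - ty s * ny s)
        - (tx s * tx s - ty s * ty s) * (nx s * nx s - ny s * ny s)); [ring|].
      rewrite Htt Hnn Htn -ee. ring. }
    assert (a0 : a = 0).
    { transitivity ((tx s * ny s - ty s * nx s) *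
        ((a * tx s + b * ty s + 0 * tz s) * ny s
         - (a * nx s - - b * ny s + 0 * w s) * ty s)); [|rewrite HA HG; ring].
      transitivity (a * 1); [ring|]. rewrite -D. ring. }
    assert (b0 : b = 0).
    { transitivity ((tx s * ny s - ty s * nx s) *
        (tx s * (a * nx s - - b * ny s + 0 * w s)
         - nx s * (a * tx s + b * ty s + 0 * tz s))); [|rewrite HA HG; ring].
      transitivity (b * 1); [ring|]. rewrite -D. ring. }
    destruct abc as [|[|]]; contradiction.
  + intros s Is. rewrite -(proj2 (Hg s Is)). ring.
Qed.

(** For [sigma = 0] the vector [(X, Y)] is constant and gives the normal of the
plane. *)
Lemma plane_of_relation (g c : R) :
  g <> 0 \/ c <> 0 ->
  (forall s, I s -> mu s * (g + c * theta s) = 0) ->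
  exists a b d, (a <> 0 \/ b <> 0 \/ c <> 0) /\
    forall s, I s -> a * x s + b * y s + c * z s = d.
Proof.
intros gc H.
destruct (support_of_relation 0 c g) as [X [Y [DX [DY HXY]]]].
{ intros s Is. rewrite (H s Is). ring. }
destruct rm as [Dx Dy Dz _ _ _ _ _ _ _ _ _ _ _].
destruct (proj2 hI) as [s0 [_ [Is0 _]]].
assert (EX : forall s, I s -> X s = X s0).
{ intros s Is. refine (constant_of_zero_derivative hI DX _ s s0 Is Is0).
  intros r _. ring. }
assert (EY : forall s, I s -> Y s = Y s0).
{ intros s Is. refine (constant_of_zero_derivative hI DY _ s s0 Is Is0).
  intros r _. ring. }
exists (X s0), (- Y s0), (X s0 * x s0 + - Y s0 * y s0 + c * z s0). split.
- destruct (HXY s0 Is0) as [_ [HG _]].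
  destruct (Req_dec c 0) as [c0|]; [|auto].
  destruct (Req_dec (X s0) 0) as [X0|]; [|auto].
  right; left. intros Y0. assert (Y0' : Y s0 = 0) by lra.
  rewrite c0 X0 Y0' in HG. destruct gc; [|contradiction].
  assert (g = 0) by lra. contradiction.
- intros s Is.
  refine (constant_of_zero_derivative hI (diff_on_plus (diff_on_plus
    (diff_on_scal (X s0) Dx) (diff_on_scal (- Y s0) Dy))
    (diff_on_scal c Dz)) _ s s0 Is Is0).
  intros r Ir. simpl. destruct (HXY r Ir) as [HA _].
  rewrite (EX r Ir) (EY r Ir) in HA. rewrite -HA. ring.
Qed.

End RMEquations.

(** * Irreducibility of the sphere polynomial *)

Section Irreducibility.
Import GRing.Theory.
Local Open Scope ring_scope.

Lemma meval_affine {K : comNzRingType} {n : nat} (p : {mpoly K[n]})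
    (v : 'I_n -> K) :
  (msize p <= 2)%N -> p.@[v] = p@_0%MM + \sum_i p@_U_(i)%MM * v i.
Proof.
move=> size_p.
have {1}-> : p = (p@_0%MM)%:MP + \sum_i p@_U_(i)%MM *: 'X_i.
  apply/mpolyP=> m; rewrite mcoeffD mcoeffC (raddf_sum (mcoeff m)) /=.
  have [->|m_nz] := eqVneq m 0%MM.
    rewrite mulr1 big1 ?addr0 // => i _.
    by rewrite mcoeffZ mcoeffX mnm1_eq0 mulr0.
  rewrite mulr0 add0r.
  have [/mdeg1P[i /eqP ->]|m_ne1] := boolP (mdeg m == 1%N).
    rewrite (bigD1 i) //= mcoeffZ mcoeffX eqxx mulr1 big1 ?addr0 // => j ji.
    by rewrite mcoeffZ mcoeffXU (negbTE ji) mulr0.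
  rewrite memN_msupp_eq0; last first.
    apply/msize_mdeg_ge/(leq_trans size_p).
    by case: (mdeg m) (mdeg_eq0 m) m_ne1 => [|[|]] //; rewrite (negbTE m_nz).
  rewrite big1 // => i _; rewrite mcoeffZ mcoeffX.
  case: eqP => [e|_]; last by rewrite mulr0.
  by rewrite -e mdeg1 in m_ne1.
rewrite mevalD mevalC (raddf_sum (meval v)) /=; congr (_ + _).
by apply: eq_bigr => i _; rewrite mevalZ mevalXU.
Qed.

(** Degrees add under multiplication, so a factorisation of a polynomial of degree
at most two into nonunits has two affine factors. Factoring is thereby
reduced to an identity between functions. *)
Lemma irreducible_quadratic {n : nat} (p : {mpoly R[n]}) (u v : 'I_n -> R) :
  (msize p <= 3)%N -> p.@[u] <> p.@[v] ->
  (forall (a0 b0 : R) (a b : 'I_n -> R),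
     ~ forall w, p.@[w] = (a0 + \sum_i a i * w i) * (b0 + \sum_i b i * w i)) ->
  irreducible_mpoly p.
Proof.
move=> size_p p_uv p_prod.
have p_nz : p != 0 by apply/eqP=> p0; apply: p_uv; rewrite p0 !meval0.
have const_unit (q : {mpoly R[n]}) : q != 0 -> (msize q <= 1)%N ->
    q \is a GRing.unit.
  move=> q_nz /msize1_polyC q_c; rewrite q_c mpolyC_eq0 in q_nz.
  apply/unitrP; exists ((q@_0%MM)^-1)%:MP.
  by rewrite q_c -!mpolyCM mcoeffC eqxx mulr1 mulVf ?mulfV.
split=> // [|q r p_qr].
  apply/negP => /andP[/eqP p_c _]; apply: p_uv.
  by rewrite p_c !mevalC.
have q_nz : q != 0 by apply: contraNneq p_nz => q0; rewrite p_qr q0 mul0r.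
have r_nz : r != 0 by apply: contraNneq p_nz => r0; rewrite p_qr r0 mulr0.
have [q_small|q_big] := leqP (msize q) 1; first by left; apply: const_unit.
have [r_small|r_big] := leqP (msize r) 1; first by right; apply: const_unit.
have size_qr : ((msize q + msize r).-1 <= 3)%N by rewrite -msizeM // -p_qr.
have size_q : (msize q <= 2)%N.
  by case: (msize q) (msize r) r_big size_qr q_big => [|[|[|k]]] [|[|l]] //; rewrite !addnS.
have size_r : (msize r <= 2)%N.
  by case: (msize q) (msize r) q_big size_qr r_big => [|[|k]] [|[|[|l]]] //; rewrite !addnS.
exfalso; apply: (p_prod q@_0%MM r@_0%MM (fun i => q@_U_(i)%MM) (fun i => r@_U_(i)%MM)) => w.
by rewrite p_qr mevalM !meval_affine.
Qed.

Lemma msize_sphere_poly (c1 c2 c3 c4 : R) :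
  (msize (sphere_poly c1 c2 c3 c4) <= 3)%N.
Proof.
have size_lin (c : R) (i : 'I_3) : (msize (c *: 'X_i : {mpoly R[3]}) <= 3)%N.
  by apply: leq_trans (msizeZ_le _ _) _; rewrite msizeX mdeg1.
have size_sq (i : 'I_3) : (msize ('X_i ^+ 2 : {mpoly R[3]}) <= 3)%N.
  by rewrite mpolyXn msizeX mdegMn mdeg1.
rewrite /sphere_poly.
do ![apply: leq_trans (msizeD_le _ _) _; rewrite geq_max; apply/andP; split];
  rewrite ?msizeN //.
by rewrite msizeC; case: (_ != 0).
Qed.

End Irreducibility.

Lemma meval_sphere_poly (c1 c2 c3 c4 : R) (p : vec3) :
  (sphere_poly c1 c2 c3 c4).@[coords p]%R =
  cx p * cx p - cy p * cy p + 2 * c1 * cx p + 2 * c2 * cy p + 2 * c3 * cz p + c4.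
Proof.
rewrite /sphere_poly !mevalD mevalN !mevalZ !GRing.rmorphXn /= !mevalXU mevalC /coords.
by rewrite !inordK //= !GRing.expr2.
Qed.

(** Evaluating at ten points compares coefficients. That of [z^2] kills one
[z]-coefficient and that of [x z] the other, hence [c3 = 0];
the leading forms are then multiples of [x + y] and [x - y], which forces
[c4 = c1^2 - c2^2]. *)
Lemma sphere_not_affine_product (c1 c2 c3 c4 a0 a1 a2 a3 b0 b1 b2 b3 : R) :
  (forall x y z : R,
     x * x - y * y + 2 * c1 * x + 2 * c2 * y + 2 * c3 * z + c4 =
     (a0 + (a1 * x + (a2 * y + a3 * z))) * (b0 + (b1 * x + (b2 * y + b3 * z)))) ->
  c3 = 0 /\ c4 = c1 * c1 - c2 * c2.
Proof.
intros H.
pose proof (H 0 0 0) as H000. pose proof (H 1 0 0) as H100.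
pose proof (H (-1) 0 0) as Hm00. pose proof (H 0 1 0) as H010.
pose proof (H 0 (-1) 0) as H0m0. pose proof (H 0 0 1) as H001.
pose proof (H 0 0 (-1)) as H00m. pose proof (H 1 1 0) as H110.
pose proof (H 1 0 1) as H101. pose proof (H 0 1 1) as H011.
clear H.
assert (E11 : a1 * b1 = 1) by lra.
assert (E22 : a2 * b2 = -1) by lra.
assert (E33 : a3 * b3 = 0) by lra.
assert (E12 : a1 * b2 + a2 * b1 = 0) by lra.
assert (E13 : a1 * b3 + a3 * b1 = 0) by lra.
assert (E01 : a0 * b1 + a1 * b0 = 2 * c1) by lra.
assert (E02 : a0 * b2 + a2 * b0 = 2 * c2) by lra.
assert (E03 : a0 * b3 + a3 * b0 = 2 * c3) by lra.
assert (E00 : a0 * b0 = c4) by lra.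
clear H000 H100 Hm00 H010 H0m0 H001 H00m H110 H101 H011.
assert (a1_nz : a1 <> 0) by (intros ->; lra).
assert (b1_nz : b1 <> 0) by (intros ->; lra).
assert (a3_0 : a3 = 0).
{ destruct (Rmult_integral _ _ E33) as [|b3_0]; [assumption|].
  rewrite b3_0 in E13.
  apply (Rmult_eq_reg_r b1); lra. }
assert (b3_0 : b3 = 0) by (rewrite a3_0 in E13; apply (Rmult_eq_reg_l a1); lra).
split; [rewrite a3_0 b3_0 in E03; lra|].
assert (Ea : a2 * a2 = a1 * a1).
{ replace (a2 * a2) with (a2 * a2 * (a1 * b1)) by (rewrite E11; ring).
  replace (a2 * a2 * (a1 * b1)) with (a1 * a2 * (a2 * b1)) by ring.
  replace (a2 * b1) with (- (a1 * b2)) by lra.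
  replace (a1 * a2 * (- (a1 * b2))) with (- (a1 * a1 * (a2 * b2))) by ring.
  rewrite E22; ring. }
assert (Eb : b2 * b2 = b1 * b1).
{ replace (b2 * b2) with (b2 * b2 * (a1 * b1)) by (rewrite E11; ring).
  replace (b2 * b2 * (a1 * b1)) with (b1 * b2 * (a1 * b2)) by ring.
  replace (a1 * b2) with (- (a2 * b1)) by lra.
  replace (b1 * b2 * (- (a2 * b1))) with (- (b1 * b1 * (a2 * b2))) by ring.
  rewrite E22; ring. }
assert (E : 4 * (c1 * c1 - c2 * c2) =
  a0 * a0 * (b1 * b1 - b2 * b2) + b0 * b0 * (a1 * a1 - a2 * a2)
  + 2 * (a0 * b0) * (a1 * b1 - a2 * b2)).
{ replace (4 * (c1 * c1 - c2 * c2)) with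
    ((2 * c1) * (2 * c1) - (2 * c2) * (2 * c2)) by ring.
  rewrite -E01 -E02; ring. }
rewrite Ea Eb E11 E22 E00 in E. lra.
Qed.

Lemma irreducible_sphere_poly (c1 c2 c3 c4 : R) :
  c3 <> 0 \/ c4 <> c1 * c1 - c2 * c2 ->
  irreducible_mpoly (sphere_poly c1 c2 c3 c4).
Proof.
intros Hc.
(* [1] and [-1] on the first axis give values [1 + 2 c1 + c4] and
   [1 - 2 c1 + c4], which cannot both equal the value [c4] at the origin. *)
assert (Hnc : exists u v : vec3,
  (sphere_poly c1 c2 c3 c4).@[coords u]%R <> (sphere_poly c1 c2 c3 c4).@[coords v]%R).
{ destruct (Req_dec (1 + 2 * c1) 0).
  - exists (-1, 0, 0), (0, 0, 0). rewrite !meval_sphere_poly. unfold cx, cy, cz; simpl. lra.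
  - exists (1, 0, 0), (0, 0, 0). rewrite !meval_sphere_poly. unfold cx, cy, cz; simpl. lra. }
destruct Hnc as [u [v Huv]].
apply (irreducible_quadratic _ _ _ (msize_sphere_poly c1 c2 c3 c4) Huv).
intros a0 b0 a b Hab.
destruct (sphere_not_affine_product c1 c2 c3 c4
  a0 (a ord0) (a (lift ord0 ord0)) (a (lift ord0 (lift ord0 ord0)))
  b0 (b ord0) (b (lift ord0 ord0)) (b (lift ord0 (lift ord0 ord0)))) as [E3 E4].
2: { destruct Hc; contradiction. }
intros x y z.
specialize (Hab (coords (x, y, z))).
rewrite meval_sphere_poly in Hab. unfold cx, cy, cz in Hab; simpl in Hab.
rewrite Hab. rewrite !big_ord_recl !big_ord0 /coords /=. rewrite !GRing.addr0. reflexivity.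
Qed.

(** * From the Frenet frame to the moving frame equations *)

(** The derivatives that witness the smoothness class agree on [I] with the given
[t] and [t'], by uniqueness; hence the components of [t'] are [C^1]. *)
Lemma class_C4_third_derivative (I : R -> Prop) (alpha t t' : R -> vec3) :
  is_interval I -> class_C 4 I alpha ->
  derivative_on I alpha t -> derivative_on I t t' ->
  exists d3, (forall p, p = cx \/ p = cy \/ p = cz ->
    diff_on I (fun s => p (t' s)) (fun s => p (d3 s)) /\
    cont_on I (fun s => p (d3 s))).
Proof.
intros hI [d1 [H1 [d2 [H2 [d3 [H3 [d4 [H4 _]]]]]]]] ht ht'.
assert (component : forall (p : vec3 -> R) f df, p = cx \/ p = cy \/ p = cz ->
    derivative_on I f df -> diff_on I (fun s => p (f s)) (fun s => p (df s))).
{ intros p f df [->|[->| ->]];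
    [apply derivative_on_cx|apply derivative_on_cy|apply derivative_on_cz]. }
exists d3. intros p hp. split; [|exact (diff_on_cont (component _ _ _ hp H4))].
assert (E1 : forall s, I s -> p (d1 s) = p (t s)).
{ exact (diff_on_unique hI (component _ _ _ hp H1) (component _ _ _ hp ht)). }
assert (E2 : forall s, I s -> p (d2 s) = p (t' s)).
{ refine (diff_on_unique hI _ (component _ _ _ hp ht')).
  exact (diff_on_eq_function _ E1 (component _ _ _ hp H2)). }
exact (diff_on_eq_function _ E2 (component _ _ _ hp H3)).
Qed.

(** In the Lorentzian plane, a vector orthogonal to a unit vector of square [eps]
has a square of sign [- eps]; the absolute value is the square of the
determinant, by Lagrange's identity. *)
Lemma acceleration_norm (tx ty ax ay eps : R) :
  eps * eps = 1 -> tx * tx - ty * ty = eps -> tx * ax - ty * ay = 0 ->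
  tx * ay - ax * ty <> 0 ->
  0 < sqrt (Rabs (ax * ax - ay * ay)) /\
  ax * ax - ay * ay =
    - eps * (sqrt (Rabs (ax * ax - ay * ay)) * sqrt (Rabs (ax * ax - ay * ay))).
Proof.
intros ee tt ta D.
assert (D2 : 0 < (tx * ay - ax * ty) * (tx * ay - ax * ty)) by nra.
assert (E : ax * ax - ay * ay = - eps * ((tx * ay - ax * ty) * (tx * ay - ax * ty))).
{ transitivity (eps * eps * (ax * ax - ay * ay)); [rewrite ee; ring|].
  transitivity (eps * ((tx * tx - ty * ty) * (ax * ax - ay * ay))); [rewrite tt; ring|].
  transitivity (eps * ((tx * ax - ty * ay) * (tx * ax - ty * ay)
    - (tx * ay - ax * ty) * (tx * ay - ax * ty))); [ring|].
  rewrite ta. ring. }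
assert (A : Rabs (ax * ax - ay * ay) = (tx * ay - ax * ty) * (tx * ay - ax * ty)).
{ rewrite E Rabs_mult Rabs_Ropp (Rabs_pos_eq (_ * _)); [|lra].
  assert (Rabs eps = 1); [|nra].
  assert (eps = 1 \/ eps = -1) as [-> | ->].
  { destruct (Rmult_integral (eps - 1) (eps + 1)); [lra|left|right]; lra. }
  - apply Rabs_R1.
  - rewrite Rabs_Ropp Rabs_R1. reflexivity. }
rewrite A. split; [apply sqrt_lt_R0; exact D2|].
rewrite sqrt_sqrt; [|lra]. exact E.
Qed.

(** The Frenet equations give everything except [w' = mu t_z], which amounts to
[theta' = tau] and so to the continuity of [tau]. Since [n] has square [- eps] and
[t' = mu n], one has [mu = - eps <t', n>], which is [C^1] because [t'] and [n]
are; comparing the third derivative of the height with the derivative of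
[mu n_z] then expresses [tau] through continuous functions. *)
Lemma frenet_RM_equations
  (I : R -> Prop) (alpha t t' n n1 : R -> vec3)
  (eps : R) (kappa tau theta : R -> R) :
  is_interval I -> class_C 4 I alpha ->
  derivative_on I alpha t -> derivative_on I t t' ->
  admissible I t t' -> unit_speed I eps t ->
  frenet_frame I eps t t' n kappa tau ->
  RM_frame I n tau theta n1 ->
  RM_equations I eps (fun s => - eps * kappa s) theta
    (fun s => cx (alpha s)) (fun s => cy (alpha s)) (fun s => cz (alpha s))
    (fun s => cx (t s)) (fun s => cy (t s)) (fun s => cz (t s))
    (fun s => cx (n s)) (fun s => cy (n s)) (fun s => cz (n s) - theta s).
Proof.
intros hI hC4 ht ht' hadm [heps hunit] [hk hn htau] [[s0 [theta0 [Is0 hth]]] _].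
assert (ee : eps * eps = 1) by (destruct heps as [-> | ->]; ring).
destruct (class_C4_third_derivative I alpha t t' hI hC4 ht ht') as [d3 Hd3].
destruct (Hd3 cx) as [D3x C3x]; [auto|].
destruct (Hd3 cy) as [D3y C3y]; [auto|].
destruct (Hd3 cz) as [D3z C3z]; [auto|].
pose proof (derivative_on_cx _ _ _ ht) as Dx.
pose proof (derivative_on_cy _ _ _ ht) as Dy.
pose proof (derivative_on_cz _ _ _ ht) as Dz.
pose proof (derivative_on_cx _ _ _ ht') as Dtx.
pose proof (derivative_on_cy _ _ _ ht') as Dty.
pose proof (derivative_on_cz _ _ _ ht') as Dtz.
set (mu := fun s => - eps * kappa s).
assert (mu_norm : forall s, I s -> mu s = pnorm (t' s)).
{ intros s Is. unfold mu, eta. rewrite (hk s Is). unfold eta.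
  transitivity (eps * eps * pnorm (t' s)); [ring|rewrite ee; ring]. }
assert (t_t' : forall s, I s -> cx (t s) * cx (t' s) - cy (t s) * cy (t' s) = 0).
{ intros s Is.
  pose proof (zero_derivative_of_constant hI (diff_on_minus
    (diff_on_mult Dtx Dtx) (diff_on_mult Dty Dty)) hunit s Is) as E.
  simpl in E. lra. }
assert (Hacc : forall s, I s -> 0 < mu s /\
  cx (t' s) * cx (t' s) - cy (t' s) * cy (t' s) = - eps * (mu s * mu s)).
{ intros s Is. rewrite (mu_norm s Is).
  exact (acceleration_norm _ _ _ _ _ ee (hunit s Is) (t_t' s Is) (proj2 (hadm s Is))). }
assert (mu_pos : forall s, I s -> 0 < mu s) by (intros s Is; apply (Hacc s Is)).
assert (n_E : forall s, I s -> n s = scal (/ mu s) (t' s)).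
{ intros s Is. rewrite (hn s Is). reflexivity. }
assert (mux : forall s, I s -> cx (t' s) = mu s * cx (n s)).
{ intros s Is. specialize (mu_pos s Is). rewrite (n_E s Is).
  change (cx (t' s) = mu s * (/ mu s * cx (t' s))). field. lra. }
assert (muy : forall s, I s -> cy (t' s) = mu s * cy (n s)).
{ intros s Is. specialize (mu_pos s Is). rewrite (n_E s Is).
  change (cy (t' s) = mu s * (/ mu s * cy (t' s))). field. lra. }
assert (muz : forall s, I s -> cz (t' s) = mu s * cz (n s)).
{ intros s Is. specialize (mu_pos s Is). rewrite (n_E s Is).
  change (cz (t' s) = mu s * (/ mu s * cz (t' s))). field. lra. }
assert (nn : forall s, I s -> cx (n s) * cx (n s) - cy (n s) * cy (n s) = - eps).
{ intros s Is. destruct (Hacc s Is) as [p E]. rewrite (mux s Is) (muy s Is) in E.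
  apply (Rmult_eq_reg_l (mu s * mu s)); [|nra]. lra. }
assert (tn : forall s, I s -> cx (t s) * cx (n s) - cy (t s) * cy (n s) = 0).
{ intros s Is. specialize (t_t' s Is). rewrite (mux s Is) (muy s Is) in t_t'.
  specialize (mu_pos s Is). apply (Rmult_eq_reg_l (mu s)); lra. }
assert (Dnx : diff_on I (fun s => cx (n s)) (fun s => mu s * cx (t s))).
{ refine (diff_on_eq_derivative _ _ (derivative_on_cx _ _ _ htau)).
  intros s Is. change (mu s * cx (t s) + tau s * 0 = mu s * cx (t s)). ring. }
assert (Dny : diff_on I (fun s => cy (n s)) (fun s => mu s * cy (t s))).
{ refine (diff_on_eq_derivative _ _ (derivative_on_cy _ _ _ htau)).
  intros s Is. change (mu s * cy (t s) + tau s * 0 = mu s * cy (t s)). ring. }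
assert (Dnz : diff_on I (fun s => cz (n s)) (fun s => mu s * cz (t s) + tau s)).
{ refine (diff_on_eq_derivative _ _ (derivative_on_cz _ _ _ htau)).
  intros s Is. change (mu s * cz (t s) + tau s * 1 = mu s * cz (t s) + tau s). ring. }
pose proof (diff_on_scal (- eps) (diff_on_minus
  (diff_on_mult D3x Dnx) (diff_on_mult D3y Dny))) as Dmu.
simpl in Dmu.
assert (mu_E : forall s, I s ->
  - eps * (cx (t' s) * cx (n s) - cy (t' s) * cy (n s)) = mu s).
{ intros s Is. rewrite (mux s Is) (muy s Is).
  transitivity (- eps * mu s * (cx (n s) * cx (n s) - cy (n s) * cy (n s))); [ring|].
  rewrite (nn s Is). transitivity (eps * eps * mu s); [ring|rewrite ee; ring]. }
pose proof (diff_on_eq_function _ mu_E Dmu) as Dmu'.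
pose proof (diff_on_cont Dmu') as Cmu.
set (dmu := fun s => - eps * (cx (d3 s) * cx (n s) + cx (t' s) * (mu s * cx (t s))
  - (cy (d3 s) * cy (n s) + cy (t' s) * (mu s * cy (t s))))).
assert (Cdmu : cont_on I dmu).
{ exact (cont_on_mult (diff_on_cont (diff_on_const I (- eps)))
    (cont_on_minus
      (cont_on_plus (cont_on_mult C3x (diff_on_cont Dnx))
        (cont_on_mult (diff_on_cont D3x)
          (cont_on_mult Cmu (diff_on_cont Dtx))))
      (cont_on_plus (cont_on_mult C3y (diff_on_cont Dny))
        (cont_on_mult (diff_on_cont D3y)
          (cont_on_mult Cmu (diff_on_cont Dty)))))). }
assert (tau_E : forall s, I s ->
  (cz (d3 s) - dmu s * cz (n s)) * / mu s - mu s * cz (t s) = tau s).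
{ intros s Is.
  pose proof (diff_on_unique hI D3z
    (diff_on_eq_function _ (fun r Ir => esym (muz r Ir))
      (diff_on_mult Dmu' Dnz)) s Is) as E.
  simpl in E. rewrite E. unfold dmu. specialize (mu_pos s Is). field. lra. }
assert (Ctau : cont_on I tau).
{ apply (cont_on_ext tau_E).
  apply cont_on_minus; [apply cont_on_mult|apply cont_on_mult].
  - apply cont_on_minus; [exact C3z|]. apply cont_on_mult; [exact Cdmu|].
    exact (diff_on_cont Dnz).
  - apply cont_on_inv; [|exact Cmu]. intros s Is. specialize (mu_pos s Is). lra.
  - exact Cmu.
  - exact (diff_on_cont Dtz). }
assert (Dtheta : diff_on I theta tau).
{ refine (diff_on_ext I _ _ _ _ (fun s Is => esym (hth s Is)) _
    (diff_on_plus (diff_on_RInt I tau s0 hI Is0 Ctau) (diff_on_const I theta0))).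
  intros s _. ring. }
constructor; try assumption.
- exact (diff_on_eq_derivative _ mux Dtx).
- exact (diff_on_eq_derivative _ muy Dty).
- refine (diff_on_eq_derivative _ _ Dtz).
  intros s Is. rewrite (muz s Is). ring.
- refine (diff_on_eq_derivative _ _ (diff_on_minus Dnz Dtheta)).
  intros s _. ring.
Qed.

(** * The normal development *)

Lemma unit_scal_eq0 (eps r : R) : eps * eps = 1 -> - eps * r = 0 -> r = 0.
Proof.
intros ee E. transitivity (eps * eps * r); [rewrite ee; ring|].
transitivity (- eps * (- eps * r)); [ring|]. rewrite E. ring.
Qed.

Theorem theorem9p1
  (I : R -> Prop) (alpha t t' n n1 : R -> vec3)
  (eps : R) (kappa tau theta kappa1 kappa2 : R -> R)
  (hI : is_interval I)
  (hC4 : class_C 4 I alpha)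
  (ht : derivative_on I alpha t)
  (ht' : derivative_on I t t')
  (hreg : regular I t)
  (hadm : admissible I t t')
  (hunit : unit_speed I eps t)
  (hfrenet : frenet_frame I eps t t' n kappa tau)
  (hRM : RM_frame I n tau theta n1)
  (hnat : natural_curvatures I eps kappa theta kappa1 kappa2) :
  ((exists S, is_pseudo_isotropic_sphere S /\ lies_on I alpha S) <->
   (exists L, is_line L /\ ~ L (0, 0) /\
      lies_on I (fun s => (kappa1 s, kappa2 s)) L)) /\
  ((exists P, is_plane P /\ lies_on I alpha P) <->
   (exists L, is_line L /\ L (0, 0) /\
      lies_on I (fun s => (kappa1 s, kappa2 s)) L)).
Proof.
pose proof (frenet_RM_equations I alpha t t' n n1 eps kappa tau theta
  hI hC4 ht ht' hadm hunit hfrenet hRM) as rm.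
assert (ee : eps * eps = 1) by (destruct hunit as [[-> | ->] _]; ring).
destruct hnat as [hk1 hk2]. unfold eta in hk2.
set (mu := fun s => - eps * kappa s) in rm.
assert (k1E : forall s, I s -> kappa1 s = - eps * mu s).
{ intros s Is. rewrite (hk1 s Is). unfold mu.
  transitivity (eps * eps * kappa s); [rewrite ee|]; ring. }
assert (k2E : forall s, I s -> kappa2 s = mu s * theta s) by exact hk2.
split; split.
- intros [S [[c1 [c2 [c3 [c4 [_ HS]]]]] HaS]].
  destruct (relation_of_quadric hI rm c1 c2 c3 c4) as [g Hg].
  { intros s Is. pose proof (proj1 (HS _) (HaS s Is)) as E.
    rewrite meval_sphere_poly in E. exact E. }
  exists (fun p => - eps * g * p.1 + c3 * p.2 = - eps). repeat split.
  + exists (- eps * g), c3, (- eps). split; [|reflexivity].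
    destruct (Req_dec c3 0) as [c30|]; [left|right; assumption].
    intros E. destruct (proj2 hI) as [s [_ [Is _]]]. specialize (Hg s Is).
    pose proof (unit_scal_eq0 _ _ ee E) as g0.
    rewrite c30 g0 in Hg. assert (eps0 : eps = 0) by lra. rewrite eps0 in ee. lra.
  + simpl. intros E. assert (eps0 : eps = 0) by lra. rewrite eps0 in ee. lra.
  + intros s Is. simpl. rewrite (k1E s Is) (k2E s Is).
    transitivity (eps * eps * (mu s * g) + c3 * (mu s * theta s)); [ring|].
    rewrite ee. specialize (Hg s Is). lra.
- intros [L [[a [b [c [_ HL]]]] [L0 HkL]]].
  assert (c_nz : c <> 0).
  { intros c0. apply L0, HL. simpl. rewrite c0. ring. }
  (* The coefficients for which the line reads [- eps g kappa1 + c3 kappa2 = - eps],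
     after scaling its equation by [- eps / c]. *)
  destruct (quadric_of_relation hI rm (a / c) (- eps * b / c))
    as [c1 [c2 [c4 [Hirr Hq]]]].
  { intros s Is. pose proof (proj1 (HL _) (HkL s Is)) as E. simpl in E.
    rewrite (k1E s Is) (k2E s Is) in E.
    assert (Ec : eps * c = - (a * mu s) + eps * b * mu s * theta s).
    { rewrite -E.
      transitivity (- (eps * eps) * a * mu s + eps * b * mu s * theta s);
        [ring|rewrite ee; ring]. }
    apply (Rmult_eq_reg_r c); [|exact c_nz].
    transitivity (eps * c + a * mu s - eps * b * mu s * theta s);
      [field; exact c_nz|].
    rewrite Ec. ring. }
  exists (fun p => (sphere_poly c1 c2 (- eps * b / c) c4).@[coords p]%R = 0). split.
  + exists c1, c2, (- eps * b / c), c4. split; [|reflexivity].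
    apply irreducible_sphere_poly, Hirr.
  + intros s Is. rewrite meval_sphere_poly. exact (Hq s Is).
- intros [P [[a [b [c [d [abc HP]]]]] HaP]].
  destruct (relation_of_plane hI rm a b c d abc) as [g [gc Hg]].
  { intros s Is. exact (proj1 (HP _) (HaP s Is)). }
  exists (fun p => - eps * g * p.1 + c * p.2 = 0). repeat split.
  + exists (- eps * g), c, 0. split; [|reflexivity].
    destruct gc as [g_nz|]; [left|right; assumption].
    intros E. exact (g_nz (unit_scal_eq0 _ _ ee E)).
  + simpl. ring.
  + intros s Is. simpl. rewrite (k1E s Is) (k2E s Is).
    transitivity (eps * eps * (mu s * g) + c * (mu s * theta s)); [ring|].
    rewrite ee. specialize (Hg s Is). lra.
- intros [L [[a [b [c [ab HL]]]] [L0 HkL]]].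
  assert (c0 : c = 0).
  { pose proof (proj1 (HL _) L0) as E. simpl in E. lra. }
  destruct (plane_of_relation hI rm (- eps * a) b)
    as [a' [b' [d [abd Hp]]]].
  + destruct ab as [a_nz|]; [left|right; assumption].
    intros E. exact (a_nz (unit_scal_eq0 _ _ ee E)).
  + intros s Is. pose proof (proj1 (HL _) (HkL s Is)) as E. simpl in E.
    rewrite (k1E s Is) (k2E s Is) c0 in E. rewrite -E. ring.
  + exists (fun p => a' * cx p + b' * cy p + b * cz p = d). split.
    * exists a', b', b, d. split; [exact abd|reflexivity].
    * exact Hp.
Qed.
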